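(* Let $K$ be a field and let $X$ be a $K$-valued vertex-weighted connected finite graph. Then for all vertices $u,v\in V(X)$, \[ \Bigl(\sum_{z\in V(X)}w_z\Bigr)\operatorname{adj}(\mathcal{L}_X)(u,v)=\sqrt{w_u}\sqrt{w_v}\,\kappa(X), \] where $\operatorname{adj}(\mathcal{L}_X)$ denotes the classical adjoint (adjugate) matrix of $\mathcal{L}_X$.
   Context: A (finite) graph $X$ consists of finite sets $V(X)$ and $\mathbb{E}(X)$ (directed edges), maps $o,t\colon\mathbb{E}(X)\to V(X)$, and an involution $e\mapsto\bar e$ with $\bar e\neq e$, $o(\bar e)=t(e)$; loops and multiple edges are allowed. A cycle is a closed trail (a walk using each undirected edge $\{e,\bar e\}$ at most once) of length $l$ visiting exactly $l$ distinct vertices (loops and pairs of parallel edges count as cycles). A spanning tree $T$ is a connected subgraph closed under $e\mapsto\bar e$ with no cycles and $V(T)=V(X)$; $d_T$ is its path distance; $\mathbb{E}(T_v)=\{e\in\mathbb{E}(T):d_T(v,o(e))>d_T(v,t(e))\}$. A $K$-valued vertex-weighted graph is a graph with $w\colon V(X)\to K$. Fix an algebraic closure $\bar K$ and square roots $\sqrt{w_v}\in\bar K$. $w(T_v)=\prod_{e\in\mathbb{E}(T_v)}w_{t(e)}$, $\kappa_v(X)=\sum_{T}w(T_v)$ over spanning trees $T$, $\kappa(X)=\sum_v\kappa_v(X)$. Matrices indexed by $V(X)$: $\bm{D}_X$ diagonal with $\bm{D}_X(u,u)=\sum_{e:o(e)=u}w_{t(e)}$; $\mathcal{W}_X(u,v)=\sum_{e:o(e)=u,t(e)=v}\sqrt{w_u}\sqrt{w_v}$;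 $\mathcal{L}_X=\bm{D}_X-\mathcal{W}_X$. *)

(* Defs.v *)
From HB Require Import structures.
From mathcomp Require Import all_boot all_order all_algebra.

Set Implicit Arguments.
Unset Strict Implicit.
Unset Printing Implicit Defensive.

Import GRing.Theory.

Record graph := Graph {
  vertex :> finType;
  edge : finType;
  src : edge -> vertex;
  tgt : edge -> vertex;
  rev_edge : edge -> edge;
  rev_edgeK : involutive rev_edge;
  rev_edge_neq : forall e, rev_edge e != e;
  src_rev_edge : forall e, src (rev_edge e) = tgt e }.

Arguments src {g} e.
Arguments tgt {g} e.
Arguments rev_edge {g} e.

(* In this section F : {set edge X} stands for the subgraph of X with edge    *)
(* set F and with all the vertices of X.                                      *)
Section Subgraphs.

Variable X : graph.
Implicit Types (F : {set edge X}) (u v : X) (e : edge X) (p c : seq (edge X)).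

Fixpoint walk F u v p : bool :=
  if p is e :: p' then [&& e \in F, src e == u & walk F (tgt e) v p']
  else u == v.

Definition trail p : bool := pairwise (fun e f => (f != e) && (f != rev_edge e)) p.

(* The empty walk at u visits one vertex, so it is not a cycle.               *)
Definition is_cycle F u c : bool :=
  [&& walk F u u c, trail c & #|u :: map tgt c| == size c].

Definition adjacent F : rel X :=
  fun u v => [exists e in F, (src e == u) && (tgt e == v)].

Definition connected F : bool := [forall u, forall v, connect (adjacent F) u v].

(* A trail has at most #|edge X| edges, so the bound on l excludes no cycle:  *)
(* see acyclicP.                                                              *)
Definition acyclic F : bool :=
  [forall l : 'I_#|edge X|.+1, forall c : l.-tuple (edge X), forall u,
     ~~ is_cycle F u c].

Definition spanning_tree F : bool :=
  [&& [forall e in F, rev_edge e \in F], connected F & acyclic F].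

(* The least length of a walk from u to v in F. It is less than #|X| if there *)
(* is such a walk (see dist_le, dist_walk), and has the dummy value #|X|      *)
(* otherwise.                                                                 *)
Definition dist F u v : nat :=
  find (fun n => [exists p : n.-tuple (edge X), walk F u v p]) (iota 0 #|X|).

Definition edges_toward F v : {set edge X} :=
  [set e in F | dist F v (tgt e) < dist F v (src e)].

Lemma connect_walkP F u v :
  reflect (exists p, walk F u v p) (connect (adjacent F) u v).
Proof.
apply: (iffP idP) => [/connectP[q]|[p]].
  elim: q u => [|x q IHq] u /= => [_ ->|/andP[/exists_inP[e eF] /andP[oe /eqP te]]].
    by exists [::] => /=.
  by move=> /IHq/[apply] -[p wp]; exists (e :: p); rewrite /= eF oe te.
elim: p u => [|e p IHp] u /= => [/eqP-> //|/and3P[eF oe /IHp]].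
by apply: connect_trans; apply/connect1/exists_inP; exists e; rewrite // oe /=.
Qed.

Lemma connectedP F :
  reflect (forall u v, exists p, walk F u v p) (connected F).
Proof.
apply: (iffP forallP) => [cF u v|wF u].
  exact/connect_walkP/(forallP (cF u)).
by apply/forallP => v; apply/connect_walkP.
Qed.

Lemma acyclicP F : reflect (forall u c, ~~ is_cycle F u c) (acyclic F).
Proof.
apply: (iffP idP) => [aF u c|aF].
  apply/negP => cc; have /and3P[_ tc _] := cc.
  have uc : uniq c.
    rewrite uniq_pairwise; apply: sub_pairwise tc => e f /=.
    by rewrite eq_sym => /andP[].
  have szc : size c < #|edge X|.+1 by rewrite ltnS -(card_uniqP uc) max_card.
  by move: aF => /forallP/(_ (Ordinal szc))/forallP/(_ (in_tuple c))/forallP/(_ u)/negP.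
by apply/forallP => l; apply/forallP => c; apply/forallP => u.
Qed.

Lemma dist_le F u v p : walk F u v p -> dist F u v <= size p.
Proof.
move=> wp; case: (ltnP (size p) #|X|) => [lt_p|]; last first.
  by apply: leq_trans; rewrite -[leqRHS](size_iota 0) find_size.
rewrite leqNgt; apply/negP => /(before_find 0).
by rewrite nth_iota // add0n => /= /negbT/negP[]; apply/existsP; exists (in_tuple p).
Qed.

Lemma dist_walk F u v :
  connect (adjacent F) u v -> exists2 p, walk F u v p & size p = dist F u v.
Proof.
have path_walk q (x : X) : path (adjacent F) x q ->
    exists2 p, walk F x (last x q) p & size p = size q.
  elim: q x => [|y q IHq] x /=; first by exists [::] => /=.
  case/andP=> /exists_inP[e eF /andP[oe /eqP te]] /IHq[p wp szp].
  by exists (e :: p); rewrite /= ?eF ?oe ?te ?szp.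
case/connectP=> _ /shortenP[q xq uq _] ->.
have [p wp szp] := path_walk q u xq.
have lt_p : size p < #|X|.
  by rewrite szp -ltnS -[(size q).+1]/(size (u :: q)) -(card_uniqP uq) ltnS max_card.
have hw : has (fun n => [exists p : n.-tuple (edge X), walk F u (last u q) p])
              (iota 0 #|X|).
  apply/hasP; exists (size p); first by rewrite mem_iota.
  by apply/existsP; exists (in_tuple p).
have := nth_find 0 hw; rewrite nth_iota; last by rewrite -{2}(size_iota 0 #|X|) -has_find.
by rewrite add0n => /existsP[r wr]; exists r => //; rewrite size_tuple.
Qed.

End Subgraphs.

Local Open Scope ring_scope.

Section Weights.

Variables (K : comNzRingType) (X : graph) (w : X -> K).

(* w(T_v), where T is the spanning tree with edge set F.                      *)
Definition tree_weight (F : {set edge X}) (v : X) : K :=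
  \prod_(e in edges_toward F v) w (tgt e).

Definition kappa_at (v : X) : K :=
  \sum_(F : {set edge X} | spanning_tree F) tree_weight F v.

Definition kappa : K := \sum_(v : X) kappa_at v.

End Weights.

(* Matrices indexed by X are square matrices of size #|X|, the vertex u       *)
(* having the index enum_rank u.                                              *)

Definition weighted_degree_mx (K : comNzRingType) (X : graph) (w : X -> K) :
    'M[K]_#|X| :=
  diag_mx (\row_i \sum_(e : edge X | src e == enum_val i) w (tgt e)).

(* sw v stands for the chosen square root of the weight of v.                 *)
Definition weighted_adjacency_mx (L : comNzRingType) (X : graph)
    (sw : X -> L) : 'M[L]_#|X| :=
  \matrix_(i, j)
    \sum_(e : edge X | (src e == enum_val i) && (tgt e == enum_val j))
      sw (enum_val i) * sw (enum_val j).

Definition weighted_laplacian (K L : comNzRingType) (iota : {rmorphism K -> L})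
    (X : graph) (w : X -> K) (sw : X -> L) : 'M[L]_#|X| :=
  map_mx iota (weighted_degree_mx w) - weighted_adjacency_mx sw.

(* Main.v *)
Require Import Defs.
From HB Require Import structures.
From mathcomp Require Import all_boot all_order all_algebra perm zify.

(******************************************************************************)
(* The vector (sqrt w_v)_v lies in the kernel of the symmetric matrix L_X, so *)
(* row and column relations between cofactors reduce the identity to the      *)
(* matrix-tree theorem adj(L_X)(z,z) = kappa_z(X) for each vertex z. For the  *)
(* latter, the (z,z) minor is, permutation by permutation, that of D - A W    *)
(* with W = diag(w). Row u of D - A W is the sum over the edges e leaving u   *)
(* of w_{t(e)} times the difference of the basis vectors at o(e) and t(e), so *)
(* by multilinearity the minor is a sum over choices of an edge leaving each  *)
(* vertex other than z. A choice contributes the product of its weights       *)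
(* w_{t(e)} if its edges lead every vertex to z, and 0 otherwise. The choices *)
(* of the first kind are the edge sets E(T_z) of the spanning trees T.        *)
(******************************************************************************)

Set Implicit Arguments.
Unset Strict Implicit.
Unset Printing Implicit Defensive.

Import GRing.Theory.

(** * Walks, spanning trees and arborescences *)

(** Two uses of [adj_ker_proportional], with the symmetry of the adjugate, give w_z adj(u,v) =
    sqrt(w_u) sqrt(w_v) adj(z,z); summing over z leaves the matrix-tree identity
    [adj_weighted_laplacian_diag]. Its algebraic side is [det_rooted_laplacian], where [det_step_mx]
    decides which choices of edges survive. Its combinatorial side is [kappa_at_arborescences]:
    orienting spanning trees towards z is a bijection onto arborescences. One direction rests on
    [reduced_walk_uniq], the uniqueness of walks without backtracking in a forest, the other on
    [reduced_walk_away]. No step divides by a weight, so zero weights are covered. *)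

Lemma not_pairwiseP (T : Type) (r : rel T) (s : seq T) :
  ~~ pairwise r s ->
  exists a x b y c, s = a ++ x :: b ++ y :: c /\ ~~ r x y.
Proof.
elim: s => [//|x s IHs] /=; rewrite negb_and => /orP[|/IHs[a [y [b [z [c [-> ryz]]]]]]]; last first.
  by exists (x :: a), y, b, z, c.
rewrite -has_predC => /split_find[y b c /= rxy _]; exists [::], x, b, y, c.
by rewrite cat_rcons.
Qed.

Section Walks.

Variable X : graph.
Implicit Types (F A : {set edge X}) (u v z : X) (e f : edge X) (p q : seq (edge X)).

Definition symmetric_edges F := forall e, e \in F -> rev_edge e \in F.

Definition reduced p : bool := sorted (fun e f => f != rev_edge e) p.

Definition rev_walk p := rev (map rev_edge p).

Lemma tgt_rev_edge e : tgt (rev_edge e) = src e.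
Proof. by rewrite -src_rev_edge rev_edgeK. Qed.

Lemma walk_cat F u v z p q : walk F u v p -> walk F v z q -> walk F u z (p ++ q).
Proof.
elim: p u => [|e p IHp] u /=; first by move/eqP->.
by case/and3P=> -> -> wp wq; apply: IHp.
Qed.

Lemma walk_cat_inv F u z p q :
  walk F u z (p ++ q) -> exists2 v, walk F u v p & walk F v z q.
Proof.
elim: p u => [|e p IHp] u /=; first by exists u.
by case/and3P=> eF oe /IHp[v wp wq]; exists v; rewrite // eF oe.
Qed.

Lemma walk_rev F u v p : symmetric_edges F -> walk F u v p -> walk F v u (rev_walk p).
Proof.
move=> symF; elim: p u => [|e p IHp] u /=; first by move/eqP->; rewrite eqxx.
case/and3P=> eF /eqP <- /IHp wp; rewrite /rev_walk /= rev_cons -cats1.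
apply: walk_cat wp _ => /=.
by rewrite symF //= src_rev_edge tgt_rev_edge !eqxx.
Qed.

Lemma reduced_rev p : reduced p -> reduced (rev_walk p).
Proof.
rewrite /reduced /rev_walk rev_sorted sorted_map.
by apply: sub_sorted => e f /=; rewrite rev_edgeK eq_sym.
Qed.

Lemma reduced_cat_inv p q : reduced (p ++ q) -> reduced p /\ reduced q.
Proof. by case/cat_sorted2. Qed.

(** By induction on length, every closed proper subwalk is empty. Hence no edge recurs, forwards or
    reversed, and no target recurs, so a nonempty walk would be a cycle. *)
Lemma closed_reduced_nil F u p :
  acyclic F -> walk F u u p -> reduced p -> p = [::].
Proof.
move=> /acyclicP aF; have [n] := ubnP (size p).
elim: n u p => // n IHn u p lt_p wp rp.
have shorter v a q c : p = a ++ q ++ c -> 0 < size a + size c -> walk F v v q -> q = [::].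
  move=> defp ac wq; apply: (IHn v) => //.
    by move: lt_p; rewrite defp !size_cat; lia.
  by move: rp; rewrite defp => /reduced_cat_inv[_ /reduced_cat_inv[]].
pose r e f := [&& f != e, f != rev_edge e & tgt f != tgt e].
have [pr|] := boolP (pairwise r p); last first.
  case/not_pairwiseP=> a [e [b [f [c [defp nref]]]]]; exfalso.
  move: wp; rewrite {1}defp => /walk_cat_inv[v _ /= /and3P[eF /eqP ov]].
  case/walk_cat_inv=> v' wb /= /and3P[fF /eqP ov' _].
  move: nref; rewrite /r !negb_and !negbK => /or3P[]/eqP Ef.
  (* In the three cases the shorter closed walk is [e :: b], [b] and [rcons b f]; in the second, [b]
     being empty makes [e] and its reverse adjacent. *)
  - suff: e :: b = [::] by [].
    apply: (shorter v a _ (f :: c)); rewrite ?addnS //.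
    by move: wb; rewrite -ov' Ef ov /= eF ov eqxx.
  - have b0 : b = [::].
      apply: (shorter (tgt e) (rcons a e) _ (f :: c)); rewrite ?addnS ?cat_rcons //.
      by move: wb; rewrite -ov' Ef src_rev_edge.
    move: rp; rewrite defp b0 => /reduced_cat_inv[_].
    by rewrite /reduced /= Ef eqxx.
  - suff: rcons b f = [::] by case: (b).
    apply: (shorter (tgt e) (rcons a e) _ c); rewrite ?size_rcons ?cat_rcons //.
    by rewrite -cats1; apply: walk_cat wb _; rewrite /= fF ov' Ef !eqxx.
case: p wp pr {IHn lt_p rp shorter} => // e p wp pr; exfalso.
have /negP[] := aF u (e :: p); rewrite /is_cycle wp /=.
apply/andP; split.
  by apply: (@sub_pairwise _ r) pr => x y /and3P[-> ->].
have uq : uniq (map tgt (e :: p)).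
  rewrite uniq_pairwise pairwise_map; apply: sub_pairwise pr => x y /and3P[_ _].
  by rewrite /= eq_sym.
(* [is_cycle] also counts the base point, which is already the last target. *)
have um : u \in map tgt (e :: p).
  have wl x q : walk F x u q -> u = last x (map tgt q).
    by elim: q x => [|g q IHq] x /= => [/eqP|/and3P[_ _ /IHq]].
  by rewrite [X in X \in _](wl _ _ wp) /= mem_last.
by rewrite cardU1 um (card_uniqP uq) /= size_map.
Qed.


Lemma reduced_join p e f q :
  reduced (rcons p e) -> reduced (f :: q) -> f != rev_edge e -> reduced (rcons p e ++ f :: q).
Proof.
case: p => [|g p] /= rp rq fe; first by rewrite fe.
by rewrite cat_path rp last_rcons /= fe.
Qed.

(** Common first edges are stripped. At the first disagreement, the reverse of one walk followed by
    the other is closed and reduced, yet nonempty. *)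
Lemma reduced_walk_uniq F u v p q :
    symmetric_edges F -> acyclic F ->
    walk F u v p -> reduced p -> walk F u v q -> reduced q ->
  p = q.
Proof.
move=> symF aF; elim: p u q => [|e p IHp] u q wp rp wq rq; first by move: wp wq => /= /eqP-> /closed_reduced_nil->.
case: q wq rq => [|f q] wq rq.
  by move: wq wp => /eqP-> /closed_reduced_nil->.
have [ef|nef] := eqVneq e f.
  case: f / ef wq rq => wq rq; congr (_ :: _); apply: (IHp (tgt e)).
  - by case/and3P: wp.
  - exact: path_sorted rp.
  - by case/and3P: wq.
  - exact: path_sorted rq.
suff: rev_walk (f :: q) ++ e :: p = [::] by move/(congr1 size); rewrite size_cat addnS.
apply: (closed_reduced_nil aF) (walk_cat (walk_rev symF wq) wp) _.
move: (reduced_rev rq); rewrite {1}/rev_walk map_cons rev_cons => rfq.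
by rewrite /rev_walk map_cons rev_cons; apply: reduced_join; rewrite ?rev_edgeK.
Qed.

Lemma dist_edge F e v :
  e \in F -> connect (adjacent F) (tgt e) v -> dist F (src e) v <= (dist F (tgt e) v).+1.
Proof.
move=> eF /dist_walk[p wp <-]; apply: (@dist_le _ _ _ _ (e :: p)).
by rewrite /= eF eqxx.
Qed.

Lemma dist_refl F u : dist F u u = 0.
Proof. by apply/eqP; rewrite -leqn0; apply: (@dist_le _ _ _ _ [::]) => /=. Qed.

Lemma connect_rev F u v :
  symmetric_edges F -> connect (adjacent F) u v -> connect (adjacent F) v u.
Proof.
move=> symF /connect_walkP[p /(walk_rev symF) wp].
by apply/connect_walkP; exists (rev_walk p).
Qed.

Lemma dist_sym F u v : symmetric_edges F -> connect (adjacent F) u v -> dist F u v = dist F v u.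
Proof.
move=> symF c; have c' := connect_rev symF c.
apply/eqP; rewrite eqn_leq; apply/andP; split.
  have [p /(walk_rev symF)/dist_le + <-] := dist_walk c'.
  by rewrite size_rev size_map.
have [p /(walk_rev symF)/dist_le + <-] := dist_walk c.
by rewrite size_rev size_map.
Qed.

Lemma geodesic_reduced F u v p : walk F u v p -> size p = dist F u v -> reduced p.
Proof.
elim: p u => // e p IHp u /= /and3P[eF /eqP <- wp] szp.
have szp' : size p = dist F (tgt e) v.
  apply/eqP; rewrite eqn_leq dist_le // -ltnS szp dist_edge //.
  by apply/connect_walkP; exists p.
have {szp'} := IHp _ wp szp'; case: p wp szp {IHp} => //= f p /and3P[fF _ wp] szp rp.
rewrite /reduced /= andbC [path _ _ _]rp /=; apply/negP => /eqP fe.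
by move: wp; rewrite fe tgt_rev_edge => /dist_le; lia.
Qed.

Lemma geodesicP F u v : connect (adjacent F) u v ->
  exists p, [/\ walk F u v p, reduced p & size p = dist F u v].
Proof.
by case/dist_walk=> p wp szp; exists p; split=> //; apply: geodesic_reduced wp szp.
Qed.

(** This characterizes the sets E(T_z) without mentioning T. That the underlying graph is a forest
    is a consequence, [symmetrize_acyclic]. *)
Definition arborescence A z : bool :=
  [&& [forall e in A, src e != z],
      [forall e in A, forall f in A, (src e == src f) ==> (e == f)]
    & [forall u, connect (adjacent A) u z]].

Lemma arborescenceP A z :
  reflect [/\ forall e, e \in A -> src e != z,
              forall e f, e \in A -> f \in A -> src e = src f -> e = f
            & forall u, connect (adjacent A) u z]
          (arborescence A z).
Proof.
apply: (iffP and3P) => [[/forall_inP A1 /forall_inP A2 /forallP A3]|[A1 A2 A3]].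
  split=> // e f /A2/forall_inP/(_ f) h /h /implyP + ef.
  by rewrite ef eqxx => /(_ isT)/eqP.
split; [exact/forall_inP| |exact/forallP].
apply/forall_inP => e eA; apply/forall_inP => f fA; apply/implyP => /eqP.
by move/(A2 _ _ eA fA)->.
Qed.

Definition symmetrize A : {set edge X} := [set e | (e \in A) || (rev_edge e \in A)].

Lemma symmetrize_sym A : symmetric_edges (symmetrize A).
Proof. by move=> e; rewrite !inE rev_edgeK orbC. Qed.

Lemma spanning_treeP F :
  reflect [/\ symmetric_edges F, forall u v, connect (adjacent F) u v & acyclic F]
          (spanning_tree F).
Proof.
apply: (iffP and3P) => [[/forall_inP sF cF aF]|[sF cF aF]]; split=> //.
- by move=> u v; move: cF => /forallP/(_ u)/forallP.
- exact/forall_inP.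
- by apply/forallP => u; apply/forallP => v.
Qed.

(** * Orienting a spanning tree towards its root *)

Section SpanningTree.

Variables (F : {set edge X}) (z : X).
Hypothesis treeF : spanning_tree F.

Let symF : symmetric_edges F. Proof. by case/spanning_treeP: treeF. Qed.
Let conF u v : connect (adjacent F) u v. Proof. by case/spanning_treeP: treeF. Qed.
Let acyF : acyclic F. Proof. by case/spanning_treeP: treeF. Qed.

Lemma edges_towardE e :
  (e \in edges_toward F z) = (e \in F) && (dist F (tgt e) z < dist F (src e) z).
Proof. by rewrite inE !(dist_sym symF (conF z _)). Qed.

(** Prepend [e] to a geodesic from its target. If the result is reduced, uniqueness makes it the
    geodesic from the source, which is then too long; otherwise the geodesic starts by traversing
    [e] backwards, so the source is nearer. *)
Lemma tree_edge_geodesic e : e \in F -> dist F (src e) z <= dist F (tgt e) z ->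
  dist F (src e) z < dist F (tgt e) z.
Proof.
move=> eF le; have [p [wp rp szp]] := geodesicP (conF (tgt e) z).
have [q [wq rq szq]] := geodesicP (conF (src e) z).
have wep : walk F (src e) z (e :: p) by rewrite /= eF eqxx.
have [rep|] := boolP (reduced (e :: p)).
  have := reduced_walk_uniq symF acyF wep rep wq rq.
  by move/(congr1 size) => /=; lia.
case: p wp rp szp {wep} => [//|f p] /and3P[_ _ wp] rp szp.
rewrite /reduced /= [path _ _ _]rp andbT negbK => /eqP fe.
by move: wp szp; rewrite fe tgt_rev_edge /= => /dist_le; lia.
Qed.

Lemma symmetrize_edges_toward : symmetrize (edges_toward F z) = F.
Proof.
apply/setP=> e; rewrite in_set !edges_towardE src_rev_edge tgt_rev_edge.
have -> : (rev_edge e \in F) = (e \in F).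
  by apply/idP/idP => /symF; rewrite ?rev_edgeK.
have [eF|//] /= := boolP (e \in F).
by have [//|/(tree_edge_geodesic eF)->] := ltnP.
Qed.

(** An edge towards [z] followed by a geodesic is a reduced walk, so uniqueness of such walks allows
    only one such edge out of each vertex. *)
Lemma edges_toward_arborescence : arborescence (edges_toward F z) z.
Proof.
have step e : e \in edges_toward F z ->
    exists2 p, walk F (src e) z (e :: p) & reduced (e :: p).
  rewrite edges_towardE => /andP[eF lt].
  have [p [wp rp szp]] := geodesicP (conF (tgt e) z).
  exists p; first by rewrite /= eF eqxx.
  rewrite /reduced; case: p wp rp szp => [//|f p] /and3P[_ _ wp] rp szp.
  rewrite /= [path _ _ _]rp andbT; apply/eqP => fe.
  by move: wp szp; rewrite fe tgt_rev_edge /= => /dist_le; lia.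
apply/arborescenceP; split=> [e|e f|u].
- by rewrite edges_towardE => /andP[_]; apply: contraTneq => ->; rewrite dist_refl.
- move=> /step[p wp rp] /step[q wq rq] ef; move: wq; rewrite -ef => wq.
  by case: (reduced_walk_uniq symF acyF wp rp wq rq).
have [n] := ubnP (dist F u z); elim: n u => // n IHn u lt.
have [->//|uz] := eqVneq u z.
have [[|e p] [wp _ szp]] := geodesicP (conF u z); first by rewrite -(eqP wp) eqxx in uz.
case/and3P: wp => eF /eqP oe /dist_le lep.
apply: (@connect_trans _ _ (tgt e)); last by apply: IHn; move: szp => /=; lia.
apply/connect1/exists_inP; exists e; rewrite ?oe ?eqxx // edges_towardE eF oe.
by move: szp => /=; lia.
Qed.

End SpanningTree.

(** * Forgetting the orientation of an arborescence *)

Section Arborescence.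

Variables (A : {set edge X}) (z : X).
Hypothesis arbA : arborescence A z.

Let rootA e : e \in A -> src e != z. Proof. by case/arborescenceP: arbA => h _ _ /h. Qed.
Let uniqA e f : e \in A -> f \in A -> src e = src f -> e = f.
Proof. by case/arborescenceP: arbA => _ h _; apply: h. Qed.
Let conA u : connect (adjacent A) u z. Proof. by case/arborescenceP: arbA. Qed.

Lemma arborescence_dist e : e \in A -> dist A (src e) z = (dist A (tgt e) z).+1.
Proof.
move=> eA; apply/eqP; rewrite eqn_leq dist_edge //=.
have [[|f p] wp <-] := dist_walk (conA (src e)).
  by case/negP: (rootA eA).
by case/and3P: wp => fA /eqP/(uniqA fA eA)-> /dist_le; rewrite ltnS.
Qed.

Let F := symmetrize A.

Lemma mem_symmetrize e : e \in F -> e \in A \/ rev_edge e \in A.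
Proof. by rewrite inE => /orP. Qed.

Lemma symmetrize_connect u v : connect (adjacent F) u v.
Proof.
have con x : connect (adjacent F) x z.
  apply: connect_sub (conA x) => a b /exists_inP[e eA ab]; apply/connect1/exists_inP.
  by exists e; rewrite // inE eA.
exact/(connect_trans (con u))/(connect_rev (@symmetrize_sym A)).
Qed.

(** Crossing an edge of [F] in either direction changes the distance to [z] in [A] by exactly one,
    so added reversals give no shortcut. *)
Lemma symmetrize_dist u : dist F u z = dist A u z.
Proof.
apply/eqP; rewrite eqn_leq; apply/andP; split.
  have [p wp <-] := dist_walk (conA u); apply: dist_le.
  elim: p u wp => //= e p IHp u /and3P[eA -> /IHp->].
  by rewrite inE eA.
have [p wp <-] := dist_walk (symmetrize_connect u z).
elim: p u wp => [u /eqP->|e p IHp u]; first by rewrite dist_refl.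
case/and3P=> eF /eqP <- /IHp /= le.
case: (mem_symmetrize eF) => /arborescence_dist; last rewrite src_rev_edge tgt_rev_edge.
  by move->.
by move: le; lia.
Qed.

Lemma edges_toward_symmetrize : edges_toward F z = A.
Proof.
apply/setP => e; rewrite inE -!(dist_sym (@symmetrize_sym A) (symmetrize_connect _ z)).
rewrite !symmetrize_dist; apply/andP/idP => [[/mem_symmetrize[//|]]|eA].
  by move/arborescence_dist; rewrite src_rev_edge tgt_rev_edge => ->; lia.
by rewrite inE eA (arborescence_dist eA).
Qed.

(* A reduced walk cannot turn back towards z: the only edge of A leaving the  *)
(* end of a reversed edge of A is that edge.                                  *)
Lemma reduced_walk_away u v e p :
    walk F u v (e :: p) -> reduced (e :: p) -> rev_edge e \in A ->
  dist A u z < dist A v z.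
Proof.
elim: p u e => [|f p IHp] u e /=.
  case/and3P=> _ /eqP<- /eqP<- _ /arborescence_dist.
  by rewrite src_rev_edge tgt_rev_edge => ->.
case/and3P=> _ /eqP<- wp; rewrite /reduced /= => /andP[fe rp] eA.
have lt : dist A (src e) z < dist A (tgt e) z.
  by have := arborescence_dist eA; rewrite src_rev_edge tgt_rev_edge => ->.
apply: ltn_trans lt _; apply: IHp (wp) rp _.
case/and3P: wp => fF /eqP of_ _; case: (mem_symmetrize fF) => // fA.
by case/eqP: fe; apply: uniqA; rewrite ?src_rev_edge.
Qed.

Lemma reduced_walk_toward u v e p :
    walk F u v (rcons p e) -> reduced (rcons p e) -> e \in A ->
  dist A v z < dist A u z.
Proof.
move=> /(walk_rev (@symmetrize_sym A)) wp /reduced_rev; move: wp.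
rewrite /rev_walk map_rcons rev_rcons => wp rp eA.
by apply: reduced_walk_away wp rp _; rewrite rev_edgeK.
Qed.

(** A closed reduced walk can neither start by moving away from [z] nor end by moving towards it. So
    its first edge and the reverse of its last edge both lie in [A] and leave the base point; they
    coincide, contradicting [trail]. *)
Lemma symmetrize_acyclic : acyclic F.
Proof.
apply/acyclicP => u c; apply/negP => /and3P[wc tc /eqP szc].
have rc : reduced c.
  by apply: pairwise_sorted; apply: sub_pairwise tc => e f /andP[].
case/lastP: c wc tc szc rc => [|p g] wc tc szc rc.
  by move: szc; rewrite (card_uniqP (isT : uniq [:: u])).
have gA : rev_edge g \in A.
  have gF : g \in F by move: wc; rewrite -cats1 => /walk_cat_inv[v _ /and3P[]].
  case: (mem_symmetrize gF) => // gA.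
  by have := reduced_walk_toward wc rc gA; rewrite ltnn.
case: p wc tc szc rc => [|e p] wc tc szc rc.
  by have := reduced_walk_away wc rc gA; rewrite ltnn.
have eA : e \in A.
  case/and3P: (wc) => eF _ _; case: (mem_symmetrize eF) => // eA.
  by have := reduced_walk_away wc rc eA; rewrite ltnn.
have ou : src e = u by case/and3P: wc => _ /eqP.
have tu : tgt g = u.
  by move: wc; rewrite -cats1 => /walk_cat_inv[v _ /and3P[_ _ /eqP]].
have eg : e = rev_edge g by apply: uniqA; rewrite ?src_rev_edge ?ou.
move: tc; rewrite /= => /andP[/allP/(_ g)]; rewrite mem_rcons mem_head => /(_ isT)/andP[_].
by rewrite eg rev_edgeK eqxx.
Qed.

Lemma symmetrize_spanning_tree : spanning_tree F.
Proof.
apply/spanning_treeP; split; [exact: symmetrize_sym | exact: symmetrize_connect |].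
exact: symmetrize_acyclic.
Qed.

End Arborescence.

End Walks.

Local Open Scope ring_scope.

(** * Determinants *)

Section Determinants.

Definition replace_row (R : Type) n (i : 'I_n) (r : 'I_n -> R) (A : 'M[R]_n) :=
  \matrix_(k, j) if k == i then r j else A k j.

Lemma det_replace_row (R : comNzRingType) n (i : 'I_n) (r : 'I_n -> R) (A : 'M_n) :
  \det (replace_row i r A) = \sum_j r j * cofactor A i j.
Proof.
rewrite (expand_det_row _ i); apply: eq_bigr => j _; rewrite mxE eqxx.
congr (_ * (_ * \det _)); apply/matrixP => k l.
by rewrite !mxE eq_sym (negPf (neq_lift _ _)).
Qed.

(** This keeps a principal minor at full size, so that no reindexing of the remaining vertices is
    needed. *)
Lemma adj_diag_replace_row (R : comNzRingType) n (i : 'I_n) (A : 'M[R]_n) :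
  \adj A i i = \det (replace_row i (fun j => (j == i)%:R) A).
Proof.
rewrite mxE det_replace_row (bigD1 i) //= eqxx mul1r big1 ?addr0 // => j /negPf->.
by rewrite mul0r.
Qed.

Lemma det0_ker (R : idomainType) n (A : 'M[R]_n) (x : 'cV_n) :
  A *m x = 0 -> x != 0 -> \det A = 0.
Proof.
move=> Ax0 /negPf x0; have /eqP := congr1 (mulmx (\adj A)) Ax0.
by rewrite mulmxA mul_adj_mx mul_scalar_mx mulmx0 scalemx_eq0 x0 orbF => /eqP.
Qed.

(** Replace row [i] of [A] by x_k e_j - x_j e_k. The new row also annihilates [x], so the
    determinant vanishes, and its expansion along that row is the relation. *)
Lemma adj_ker_proportional (R : idomainType) n (A : 'M[R]_n) (x : 'cV_n) i j k :
  A *m x = 0 -> x k 0 * \adj A j i = x j 0 * \adj A k i.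
Proof.
move=> Ax0; have [->|x0] := eqVneq x 0; first by rewrite !mxE !mul0r.
pose r l := x k 0 * (l == j)%:R - x j 0 * (l == k)%:R.
have sumr (g : 'I_n -> R) : \sum_l r l * g l = x k 0 * g j - x j 0 * g k.
  rewrite (eq_bigr (fun l => x k 0 * ((l == j)%:R * g l)
                             - x j 0 * ((l == k)%:R * g l))); last first.
    by move=> l _; rewrite mulrBl !mulrA.
  rewrite sumrB -!mulr_sumr (bigD1 j) //= big1 => [|l /negPf->]; last by rewrite mul0r.
  rewrite (bigD1 k) //= big1 => [|l /negPf->]; last by rewrite mul0r.
  by rewrite !eqxx !mul1r !addr0.
rewrite 2!mxE; apply/eqP; rewrite -subr_eq0 -sumr -det_replace_row.
apply/eqP/(det0_ker _ x0)/matrixP => l m; rewrite (ord1 m) !mxE.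
have [li|li] := eqVneq l i; last first.
  have /matrixP/(_ l 0) := Ax0; rewrite [X in X = _]mxE [X in _ = X]mxE => Axl.
  rewrite -[RHS]Axl; apply: eq_bigr => q _.
  by rewrite mxE (negPf li).
rewrite (eq_bigr (fun q => r q * x q 0)) => [|q _]; last by rewrite mxE li eqxx.
by rewrite sumr mulrC subrr.
Qed.

(* Every permutation has as many factors x i as factors x (s i). *)
Lemma det_offdiag_rescale (R : comNzRingType) n (A B C : 'M[R]_n) (x : 'I_n -> R) :
    (forall i, A i i = B i i) ->
    (forall i j, i != j -> A i j = x i * C i j) ->
    (forall i j, i != j -> B i j = C i j * x j) ->
  \det A = \det B.
Proof.
move=> ABd Ao Bo; apply: eq_bigr => s _; congr (_ * _).
rewrite (bigID (fun i => i == s i)) [RHS](bigID (fun i => i == s i)) /=.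
congr (_ * _); first by apply: eq_bigr => i /eqP <-.
rewrite (eq_bigr _ (fun i => @Ao i (s i))) (eq_bigr _ (fun i => @Bo i (s i))).
rewrite !big_split /= mulrC; congr (_ * _).
rewrite (reindex_inj (@perm_inj _ s)); apply: eq_bigl => i /=.
by rewrite (inj_eq perm_inj).
Qed.

Lemma det_row_sum (R : comNzRingType) n (J : finType) (g : 'I_n -> J -> 'I_n -> R) :
  \det (\matrix_(i, j) \sum_(a : J) g i a j)
  = \sum_(f : {ffun 'I_n -> J}) \det (\matrix_(i, j) g i (f i) j).
Proof.
rewrite /determinant exchange_big /=; apply: eq_bigr => s _.
rewrite -mulr_sumr; congr (_ * _).
rewrite (eq_bigr (fun i => \sum_(a : J) g i a (s i))) => [|i _]; last by rewrite mxE.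
rewrite bigA_distr_bigA; apply: eq_bigr => f _.
by apply: eq_bigr => i _; rewrite mxE.
Qed.

Lemma det_mulmx_rows (R : comNzRingType) n (c : 'I_n -> R) (A : 'M[R]_n) :
  \det (\matrix_(i, j) (c i * A i j)) = (\prod_i c i) * \det A.
Proof.
rewrite /determinant mulr_sumr; apply: eq_bigr => s _.
rewrite mulrCA; congr (_ * _); rewrite -big_split /=.
by apply: eq_bigr => i _; rewrite mxE.
Qed.

(* h makes A triangular up to a simultaneous permutation of rows and columns. *)
Lemma det_graded_trig (R : comNzRingType) n (A : 'M[R]_n) (h : 'I_n -> nat) :
    (forall i j, i != j -> A i j != 0 -> (h j < h i)%N) ->
  \det A = \prod_i A i i.
Proof.
move=> hA; rewrite /determinant (bigD1 (1%g : 'S_n)) //= odd_perm1 mul1r [X in _ + X]big1 => [|s s1].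
  by rewrite addr0; apply: eq_bigr => i _; rewrite perm1.
have [/existsP[i /eqP Ai0]|] := boolP [exists i, A i (s i) == 0].
  by rewrite (bigD1 i) //= Ai0 mul0r mulr0.
rewrite negb_exists => /forallP nz; case/negP: s1; apply/eqP/permP => i.
(* With all entries [A j (s j)] nonzero, [s] never raises [h] and lowers it wherever it moves an
   index. Since [s] preserves the sum of [h], it moves none. *)
have le_h j : (h (s j) <= h j)%N.
  have [->//|jsj] := eqVneq (s j) j; apply/ltnW/hA; last exact: nz.
  by rewrite eq_sym.
have eq_h : (\sum_j h (s j) = \sum_j h j)%N.
  by rewrite [RHS](reindex_inj (@perm_inj _ s)).
rewrite perm1; apply/eqP/negPn/negP => si.
have : (h (s i) < h i)%N by apply: hA; [rewrite eq_sym | apply: nz].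
have /eqP := eq_h; rewrite (bigD1 i) //= [X in _ == X](bigD1 i) //=.
have : (\sum_(j | j != i) h (s j) <= \sum_(j | j != i) h j)%N by apply: leq_sum.
move=> le1 /eqP e1 lt1.
by have := leq_add lt1 le1; rewrite addSn e1 ltnn.
Qed.

End Determinants.

(** * The matrix-tree theorem *)

Lemma big_optionE (R : Type) (idx : R) (op : Monoid.com_law idx) (T : finType)
    (g : option T -> R) :
  \big[op/idx]_(o : option T) g o = op (g None) (\big[op/idx]_(a : T) g (Some a)).
Proof.
rewrite (bigD1 None) //=; congr (op _ _).
rewrite (reindex_omap Some id) => [|[a|]//]; apply: eq_bigl => a /=.
by rewrite eqxx.
Qed.

Section MatrixTree.

Variable X : graph.
Implicit Types (A F : {set edge X}) (e : edge X).
Notation out_arcs := {ffun 'I_#|X| -> option (edge X)}.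

(** T maps to E(T_z), with inverse [symmetrize]. *)
Lemma kappa_at_arborescences (R : comNzRingType) (w : X -> R) z :
  kappa_at w z = \sum_(A : {set edge X} | arborescence A z) \prod_(e in A) w (tgt e).
Proof.
rewrite /kappa_at (reindex_onto (@symmetrize X) (fun F => edges_toward F z)); last first.
  by move=> F /symmetrize_edges_toward.
apply: eq_big => [A|A /andP[_ /eqP]]; last by rewrite /tree_weight => ->.
apply/andP/idP => [[/edges_toward_arborescence + /eqP defA]|arbA].
  by move/(_ z); rewrite defA.
by rewrite (symmetrize_spanning_tree arbA) (edges_toward_symmetrize arbA).
Qed.

(* Such an f indexes a term of the multilinear expansion along the rows; the  *)
(* value None is that of the root.                                            *)
Definition rooted_choice (z : X) (f : out_arcs) : bool :=
  [forall i, if f i is Some e then (src e == enum_val i) && (src e != z)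
             else enum_val i == z].

(** An edge counts only if chosen at its own source, so each vertex has at most one arc for every
    [f], rooted or not. *)
Definition arcs (f : out_arcs) : {set edge X} :=
  [set e | f (enum_rank (src e)) == Some e].

Lemma arcsP z f i e : rooted_choice z f -> f i = Some e ->
  [/\ e \in arcs f, src e = enum_val i & src e != z].
Proof.
move=> /forallP/(_ i) + fi; rewrite fi => /andP[/eqP oe ez]; split=> //.
by rewrite inE oe enum_valK fi.
Qed.

Lemma arcs_root z f e : rooted_choice z f -> e \in arcs f -> src e != z.
Proof. by move=> rf; rewrite inE => /eqP/(arcsP rf)[]. Qed.

Lemma arcs_uniq f e e' : e \in arcs f -> e' \in arcs f -> src e = src e' -> e = e'.
Proof. by rewrite !inE => /eqP + /eqP + oe; rewrite oe => -> []. Qed.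

Definition choice_of A : out_arcs := [ffun i => [pick e in A | src e == enum_val i]].

(** When [arcs f] is an arborescence, [rooted_choice z f] holds exactly if [choice_of] recovers [f]
    from [arcs f]. *)
Lemma arborescence_sum (R : comNzRingType) (g : {set edge X} -> R) z :
  \sum_(A : {set edge X} | arborescence A z) g A
  = \sum_(f : out_arcs | rooted_choice z f && arborescence (arcs f) z) g (arcs f).
Proof.
rewrite (reindex_onto arcs choice_of) => [|A /arborescenceP[_ uA _]]; last first.
  apply/setP => e; rewrite inE ffunE; case: pickP => [e' /andP[e'A /eqP oe']|noe].
    rewrite enum_rankK in oe'; apply/eqP/idP => [[<-]//|eA].
    by congr Some; apply: uA.
  by have := noe e; rewrite enum_rankK eqxx andbT /= => ->.
apply: eq_bigl => f; rewrite andbC.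
have [/arborescenceP[rA uA cA]|] := boolP (arborescence _ _); last by rewrite !andbF.
rewrite !andbT; apply/eqP/idP => [deff|rf].
  apply/forallP => i; rewrite -deff ffunE; case: pickP => [e /andP[/rA-> ->]//|noe].
  apply/negPn/negP => iz; have /connect_walkP[[|e p]] := cA (enum_val i).
    by move/eqP=> iz'; rewrite iz' eqxx in iz.
  by case/and3P=> eA oe _; have := noe e; rewrite /= eA oe.
apply/ffunP => i; rewrite ffunE; case: pickP => [e /andP[]|noe].
  by rewrite inE => /eqP + /eqP oe; rewrite oe enum_valK.
case fi: (f i) => [e|//]; have [eA oe _] := arcsP rf fi.
by have := noe e; rewrite /= eA oe eqxx.
Qed.

Lemma prod_arcs (R : comNzRingType) (w : X -> R) z f :
  rooted_choice z f ->
  \prod_(e in arcs f) w (tgt e) = \prod_i if f i is Some e then w (tgt e) else 1.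
Proof.
move=> rf; rewrite (partition_big (fun e => enum_rank (src e)) predT) //=.
apply: eq_bigr => i _; case fi: (f i) => [e|].
  have [eA oe _] := arcsP rf fi; rewrite (big_pred1 e) // => e'.
  rewrite inE; apply/andP/eqP => [[/eqP + /eqP ie']|->].
    by rewrite ie' fi => -[].
  by rewrite oe enum_valK fi !eqxx.
by rewrite big_pred0 // => e; rewrite inE; apply/andP => -[/eqP + /eqP ie]; rewrite ie fi.
Qed.

Definition step_mx (R : nzRingType) (f : out_arcs) : 'M[R]_#|X| :=
  \matrix_(i, j) ((i == j)%:R - (if f i is Some e then (enum_rank (tgt e) == j)%:R else 0)).

(** For an arborescence, the distance to [z] grades the matrix, whose diagonal is 1. Otherwise the
    indicator of the vertices that cannot reach [z] is a nonzero kernel vector: a vertex other than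
    [z] reaches [z] exactly if the target of its chosen edge does. *)
Lemma det_step_mx (R : idomainType) z f :
  rooted_choice z f -> \det (step_mx R f) = (arborescence (arcs f) z)%:R.
Proof.
move=> rf; have [arbf|narb] := boolP (arborescence _ _).
  have di e : e \in arcs f -> tgt e != src e.
    by move=> /(arborescence_dist arbf); apply: contra_eq_neq => ->; lia.
  rewrite (det_graded_trig (h := fun i => dist (arcs f) (enum_val i) z)).
    apply: big1 => i _; rewrite mxE eqxx; case fi: (f i) => [e|]; last by rewrite subr0.
    have [/di de oe _] := arcsP rf fi.
    by rewrite -[i in _ == i]enum_valK (inj_eq enum_rank_inj) -oe (negPf de) subr0.
  move=> i j /negPf ij; rewrite mxE ij sub0r oppr_eq0.
  case fi: (f i) => [e|]; last by rewrite eqxx.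
  have [eA oe _] := arcsP rf fi.
  have [<- _|] := eqVneq (enum_rank (tgt e)) j; last by rewrite eqxx.
  by rewrite enum_rankK -oe (arborescence_dist arbf).
pose x : 'cV[R]_#|X| := \col_i (~~ connect (adjacent (arcs f)) (enum_val i) z)%:R.
apply: (@det0_ker _ _ _ x); last first.
  have [u] : exists u, ~~ connect (adjacent (arcs f)) u z.
    apply/existsP; rewrite -negb_forall; apply: contra narb => /forallP cf.
    apply/arborescenceP; split=> // e; [exact: arcs_root | exact: arcs_uniq].
  apply: contraNneq => /matrixP/(_ (enum_rank u) 0); rewrite !mxE enum_rankK => /eqP.
  by case: connect => //; rewrite oner_eq0.
apply/matrixP => i k; rewrite (ord1 k) {k} [RHS]mxE mxE.
rewrite (eq_bigr (fun j => (j == i)%:R * x j 0 -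
   (if f i is Some e then (j == enum_rank (tgt e))%:R else 0) * x j 0)); last first.
  move=> j _; rewrite mxE mulrBl eq_sym; congr (_ - _ * _).
  by case: (f i) => // e; rewrite eq_sym.
have sumx l : \sum_j (j == l)%:R * x j 0 = x l 0.
  by rewrite (bigD1 l) //= eqxx mul1r big1 ?addr0 // => j /negPf->; rewrite mul0r.
rewrite sumrB sumx; case fi: (f i) => [e|]; last first.
  move/forallP/(_ i): rf; rewrite fi => /eqP iz.
  by rewrite big1 ?subr0 => [|j _]; rewrite ?mul0r // mxE iz connect0.
rewrite sumx !mxE enum_rankK; have [eA <- ez] := arcsP rf fi.
suff -> : connect (adjacent (arcs f)) (src e) z = connect (adjacent (arcs f)) (tgt e) z.
  by rewrite subrr.
apply/idP/idP => [/connect_walkP[[|e' p]]|].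
- by rewrite /= (negPf ez).
- case/and3P=> e'A /eqP oe' wp; rewrite -(arcs_uniq e'A eA oe').
  by apply/connect_walkP; exists p.
- by apply/connect_trans/connect1/exists_inP; exists e; rewrite // !eqxx.
Qed.

(* This is D_X - A_X diag(w), for A_X the unweighted adjacency matrix, with   *)
(* the row of z replaced by that of the identity matrix.                      *)
Definition rooted_laplacian (R : nzRingType) (w : X -> R) (z : X) : 'M[R]_#|X| :=
  \matrix_(i, j) if enum_val i == z then (i == j)%:R else
    \sum_(e | src e == enum_val i)
      w (tgt e) * ((i == j)%:R - (enum_rank (tgt e) == j)%:R).

Lemma det_rooted_laplacian (R : idomainType) (w : X -> R) z :
  \det (rooted_laplacian w z) = kappa_at w z.
Proof.
(* These coefficients vanish on inadmissible values, so each row becomes a sum over all of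
   [option (edge X)] and non-rooted choices contribute 0. *)
pose c (i : 'I_#|X|) (o : option (edge X)) : R :=
  if o is Some e then if (src e == enum_val i) && (src e != z) then w (tgt e) else 0
  else (enum_val i == z)%:R.
have -> : rooted_laplacian w z = \matrix_(i, j) \sum_(o : option (edge X))
    c i o * ((i == j)%:R - (if o is Some e then (enum_rank (tgt e) == j)%:R else 0)).
  apply/matrixP => i j; rewrite !mxE big_optionE /= subr0.
  have [iz|iz] := eqVneq (enum_val i) z.
    rewrite mul1r big1 ?addr0 // => e _; rewrite iz.
    by case: eqP; rewrite /= mul0r.
  rewrite mul0r add0r [LHS]big_mkcond; apply: eq_bigr => e _.
  by have [->|] := eqVneq (src e) (enum_val i); rewrite ?iz //= mul0r.
rewrite det_row_sum kappa_at_arborescences arborescence_sum [RHS]big_mkcond /=.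
apply: eq_bigr => f _.
have -> : \matrix_(i, j) (c i (f i) * ((i == j)%:R -
    (if f i is Some e then (enum_rank (tgt e) == j)%:R else 0)))
  = \matrix_(i, j) (c i (f i) * step_mx R f i j).
  by apply/matrixP => i j; rewrite !mxE.
rewrite det_mulmx_rows; have [rf|] := boolP (rooted_choice z f); last first.
  case/forallPn=> i nci; rewrite (bigD1 i) //= /c.
  by case: (f i) nci => [e /negPf->|/negPf->]; rewrite !mul0r.
rewrite (det_step_mx _ rf) /=; case: ifP; last by rewrite mulr0.
rewrite mulr1 (prod_arcs _ rf) => _; apply: eq_bigr => i _.
by move/forallP/(_ i): rf; rewrite /c; case: (f i) => [e ->|->].
Qed.

End MatrixTree.

(** * Transfer to the symmetric Laplacian *)

Section Laplacian.

Variables (K : comNzRingType) (L : idomainType) (iota : {rmorphism K -> L}).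
Variables (X : graph) (w : X -> K) (sw : X -> L).
Hypothesis sw_sqrt : forall v : X, sw v ^+ 2 = iota (w v).

Local Notation lap := (weighted_laplacian iota w sw).

Lemma weighted_laplacianE i j :
  lap i j = (\sum_(e | src e == enum_val i) iota (w (tgt e))) *+ (i == j)
    - \sum_(e | (src e == enum_val i) && (tgt e == enum_val j))
        sw (enum_val i) * sw (enum_val j).
Proof. by rewrite !mxE rmorphMn rmorph_sum. Qed.

Lemma iota_kappa_at z : iota (kappa_at w z) = kappa_at (iota \o w) z.
Proof. by rewrite rmorph_sum; apply: eq_bigr => F _; rewrite rmorph_prod. Qed.

Lemma weighted_laplacian_tr : lap^T = lap.
Proof.
apply/matrixP => i j; rewrite mxE !weighted_laplacianE.
have [->|ij] := eqVneq i j; first by [].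
rewrite !mulr0n; congr (_ - _).
rewrite (reindex_inj (inv_inj (@rev_edgeK X))) /=.
apply: eq_big => [e|e _]; last exact: mulrC.
by rewrite src_rev_edge tgt_rev_edge andbC.
Qed.

Lemma weighted_laplacian_ker : lap *m (\col_i sw (enum_val i)) = 0.
Proof.
apply/matrixP => i k; rewrite {k}(ord1 k) [RHS]mxE mxE.
under eq_bigr do rewrite weighted_laplacianE mxE mulrBl.
rewrite sumrB; apply/eqP; rewrite subr_eq0; apply/eqP.
rewrite (bigD1 i) //= [X in _ + X]big1 ?addr0 => [|j]; last first.
  by rewrite eq_sym => /negPf->; rewrite mul0r.
rewrite eqxx mulr1n mulr_suml.
rewrite (partition_big (fun e => enum_rank (tgt e)) predT) //=; apply: eq_bigr => j _.
rewrite mulr_suml; apply: eq_big => [e|e /andP[_ /eqP <-]].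
  by rewrite -(inj_eq enum_rank_inj (tgt e)) enum_valK.
by rewrite enum_rankK -sw_sqrt expr2 mulrC mulrA.
Qed.

(** For nonzero weights, conjugation by diag(sqrt w) carries the Laplacian to D - A W.
    [det_offdiag_rescale] gives the same equality of minors without inverting the square roots. *)
Lemma adj_weighted_laplacian_diag z :
  \adj lap (enum_rank z) (enum_rank z) = iota (kappa_at w z).
Proof.
rewrite iota_kappa_at -det_rooted_laplacian adj_diag_replace_row.
pose C := \matrix_(i < #|X|, j < #|X|) if enum_val i == z then 0 else
  - \sum_(e | (src e == enum_val i) && (tgt e == enum_val j)) sw (enum_val j).
have rankz (i : 'I_#|X|) : (i == enum_rank z) = (enum_val i == z).
  by rewrite -(inj_eq enum_val_inj) enum_rankK.
apply: (@det_offdiag_rescale _ _ _ _ C (fun i => sw (enum_val i))) => [i|i j|i j].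
- rewrite [LHS]mxE weighted_laplacianE [RHS]mxE rankz eqxx; case: ifP => [->//|_].
  (* Loops at [i] cancel: they enter both the degree and the adjacency sum on the left, and have a
     zero difference of basis vectors on the right. *)
  rewrite mulr1n [RHS](eq_bigr (fun e => iota (w (tgt e)) -
      (if tgt e == enum_val i then iota (w (tgt e)) else 0))) => [|e _].
    rewrite sumrB -big_mkcondr; congr (_ - _).
    by apply: eq_bigr => e /andP[_ /eqP->]; rewrite -sw_sqrt.
  rewrite -(inj_eq enum_rank_inj) enum_valK mulrBr mulr1.
  by case: eqP; rewrite ?mulr1 ?mulr0.
- move=> /negPf ij; rewrite [LHS]mxE weighted_laplacianE !mxE !rankz ij.
  case: eqP => [iz|_]; last by rewrite mulr0n sub0r mulrN mulr_sumr.
  by rewrite -iz -(inj_eq enum_rank_inj) !enum_valK eq_sym ij mulr0.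
- move=> /negPf ij; rewrite !mxE ij; case: ifP => _; first by rewrite mul0r.
  rewrite mulNr mulr_suml -sumrN big_mkcondr; apply: eq_bigr => e _.
  rewrite -(inj_eq enum_rank_inj) enum_valK sub0r.
  case: eqP => [ej|_]; last by rewrite mulr0n oppr0 mulr0.
  by rewrite mulr1n mulrN1 /= -sw_sqrt -(enum_rankK (tgt e)) ej expr2.
Qed.

End Laplacian.

Theorem mainTheorem2 (K : fieldType) (Kbar : closedFieldType)
    (iota : {rmorphism K -> Kbar})
    (iota_alg : forall x : Kbar, algebraicOver iota x)
    (X : graph) (X_connected : connected [set: edge X])
    (w : X -> K) (sw : X -> Kbar)
    (sw_sqrt : forall v : X, sw v ^+ 2 = iota (w v))
    (u v : X) :
  iota (\sum_(z : X) w z)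
    * (\adj (weighted_laplacian iota w sw)) (enum_rank u) (enum_rank v)
  = sw u * sw v * iota (kappa w).
Proof.
rewrite !rmorph_sum mulr_suml mulr_sumr; apply: eq_bigr => z _.
rewrite -(adj_weighted_laplacian_diag sw_sqrt) -sw_sqrt expr2 -mulrA.
have prop a b c := adj_ker_proportional (enum_rank a) (enum_rank b) (enum_rank c)
  (weighted_laplacian_ker sw_sqrt).
have {}prop a b c : sw c * \adj (weighted_laplacian iota w sw) (enum_rank b) (enum_rank a)
    = sw b * \adj (weighted_laplacian iota w sw) (enum_rank c) (enum_rank a).
  by have := prop a b c; rewrite !mxE !enum_rankK.
have adjT a b : \adj (weighted_laplacian iota w sw) (enum_rank a) (enum_rank b)
    = \adj (weighted_laplacian iota w sw) (enum_rank b) (enum_rank a).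
  by rewrite -{1}weighted_laplacian_tr -trmx_adj mxE.
(* One factor [sw z] moves the row index from [u] to [z]; after transposing, the other moves [v] to
   [z]. *)
by rewrite prop mulrCA adjT prop mulrA.
Qed.
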